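(* For every finite simple graph $G$, we have $\mathrm{v}(I(G))\le \alpha_0(G)$.
   Context: $K$ is a field; $R=K[V(G)]$ is the polynomial ring whose variables are the vertices of $G$, with the standard grading, and $R_d$ is its degree-$d$ component. The edge ideal $I(G)\subset R$ is generated by the monomials $xy$ with $\{x,y\}\in E(G)$. For a proper graded ideal $I$ of $R$, its v-number is $\mathrm{v}(I)=\min\{d\ge 0 : \exists f\in R_d \text{ and } \mathfrak{p}\in\mathrm{Ass}(R/I)\text{ with } (I:f)=\mathfrak{p}\}$. $\alpha_0(G)$ is the vertex covering number of $G$: the minimum cardinality of a set of vertices meeting every edge of $G$. *)

(* Defs.v *)
From mathcomp Require Import all_boot all_algebra.
From mathcomp Require Import boolp.
From mathcomp Require Import mpoly.

Set Implicit Arguments.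
Unset Strict Implicit.
Unset Printing Implicit Defensive.

Import GRing.Theory.
Local Open Scope ring_scope.

Section Ideals.
Variable R : comNzRingType.
Implicit Types (I P S : {pred R}) (f g : R).

(* Membership is undecidable in general: it is reflected into bool
   classically by [< _ >]. *)
Definition ideal_gen S : {pred R} :=
  [pred f | `[< exists2 s : seq (R * R),
                  {in s, forall c, c.2 \in S} &
                  f = \sum_(c <- s) c.1 * c.2 >]].

Definition colon I f : {pred R} := [pred g | g * f \in I].

(* [idealr_closed] already includes 1 \notin P. *)
Definition prime_ideal P : Prop := idealr_closed P /\ prime_idealr_closed P.

(* P \in Ass(R/I): a prime ideal which is the annihilator of the class of
   some g in R/I; this annihilator is (I : g). *)
Definition associated_prime I P : Prop :=
  prime_ideal P /\ exists g, P =i colon I g.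

End Ideals.

Section VNumber.
Variables (n : nat) (K : fieldType).
Implicit Types (I : {pred {mpoly K[n]}}) (d v : nat).

Definition vnumber_degree I d : Prop :=
  exists (f : {mpoly K[n]}) (P : {pred {mpoly K[n]}}),
    [/\ f \is d.-homog, associated_prime I P & colon I f =i P].

(* v(I) = v; a relation, so that no value is chosen when no degree qualifies. *)
Definition is_vnumber I v : Prop :=
  vnumber_degree I v /\ forall d, vnumber_degree I d -> (v <= d)%N.

End VNumber.

Section Graphs.
Variables (V : finType) (adj : rel V).

Definition vertex_var (K : fieldType) (x : V) : {mpoly K[#|V|]} :=
  'X_(enum_rank x).

Definition edge_ideal (K : fieldType) : {pred {mpoly K[#|V|]}} :=
  ideal_gen [pred m | [exists x, exists y,
    adj x y && (m == vertex_var K x * vertex_var K y)]].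

Definition vertex_cover (C : {set V}) : bool :=
  [forall x, forall y, adj x y ==> (x \in C) || (y \in C)].

(* The full vertex set is always a cover, so the minimum is attained. *)
Definition vertex_covering_number : nat :=
  #|[arg min_(C < [set: V] | vertex_cover C) #|C|]|.

End Graphs.

Arguments edge_ideal {V} adj K _ : rename.

(* Main.v *)
Require Import Defs.
From HB Require Import structures.
From mathcomp Require Import mpoly boolp.
From mathcomp Require Import all_boot all_algebra.

(** Let [C] be a minimum vertex cover.  Since no proper subset of [C] covers,
    each [c] in [C] has a neighbour [f c] outside [C]: otherwise [C] minus [c]
    would still meet every edge.  Put [A := f(C)].  It lies in the complement
    of [C], which contains no edge, so [A] is stable; its neighbourhood is
    exactly [C], and it has at most [#|C|] elements
    ([small_stable_set_with_covering_nbhd]).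

    For any stable [A] whose neighbourhood [N(A)] is a vertex cover, the
    squarefree monomial [x_A] of degree [#|A|] satisfies
    [(I(G) : x_A) = (N(A))], a prime generated by variables
    ([colon_stable_monomial]).  Indeed every variable in [N(A)] times [x_A] is
    a multiple of an edge; conversely [I(G)] lies in the prime [(N(A))] because
    [N(A)] covers, and [x_A] does not because [A] is stable, so
    [g * x_A \in I(G)] forces [g] into [(N(A))].  Hence [#|A|] is one of the
    degrees that compete in the minimum defining the v-number.

    The ideal [(N(A))] is handled throughout as the kernel of the
    specialization sending the variables of [N(A)] to [0]: primality is then
    inherited from the polynomial ring being a domain, and membership is
    an equation. *)

Set Implicit Arguments.
Unset Strict Implicit.
Unset Printing Implicit Defensive.

Import GRing.Theory.
Local Open Scope ring_scope.

Section GeneratedIdeals.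
Variable R : comNzRingType.
Implicit Types (S : {pred R}) (f g : R).

Lemma mem_ideal_gen S f : f \in S -> f \in ideal_gen S.
Proof.
move=> fS; rewrite inE; apply/asboolP; exists [:: (1, f)].
  by move=> c; rewrite inE => /eqP ->.
by rewrite big_seq1 mul1r.
Qed.

Lemma ideal_gen0 S : 0 \in ideal_gen S.
Proof.
by rewrite inE; apply/asboolP; exists [::]; rewrite // big_nil.
Qed.

Lemma ideal_gen_linear S a :
  {in ideal_gen S &, forall f g, a * f + g \in ideal_gen S}.
Proof.
move=> f g; rewrite !inE => /asboolP[s sS ->] /asboolP[t tS ->].
apply/asboolP; exists ([seq (a * c.1, c.2) | c <- s] ++ t).
  by move=> c; rewrite mem_cat => /orP[/mapP[d ds ->]|]; [exact: (sS d) | exact: tS].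
rewrite big_cat big_map mulr_sumr; congr (_ + _).
by apply: eq_bigr => c _; rewrite mulrA.
Qed.

Lemma ideal_gen_ker (R' : comNzRingType) (phi : {rmorphism R -> R'}) S f :
  {in S, forall s, phi s = 0} -> f \in ideal_gen S -> phi f = 0.
Proof.
move=> phiS; rewrite inE => /asboolP[s sS ->]; rewrite rmorph_sum big_seq big1 //.
by move=> c cs; rewrite rmorphM (phiS _ (sS _ cs)) mulr0.
Qed.

End GeneratedIdeals.

Lemma prime_ideal_ker (R : comNzRingType) (D : idomainType)
    (phi : {rmorphism R -> D}) : prime_ideal [pred f | phi f == 0].
Proof.
split; first split.
- by rewrite inE rmorph0.
- by rewrite inE rmorph1 oner_eq0.
- by move=> a f g; rewrite !inE rmorphD rmorphM => /eqP-> /eqP->;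
    rewrite mulr0 addr0.
- by move=> f g; rewrite !inE rmorphM mulf_eq0.
Qed.

Section Specialization.
Variables (K : fieldType) (V : finType).
Local Notation "'R'" := {mpoly K[#|V|]}.
Local Notation x_ := (vertex_var K).
Implicit Types (A C : {set V}) (f g : R).

(** Encodes the prime ideal generated by the variables of [C], as a kernel. *)
Definition kill_vars C : R -> R :=
  comp_mpoly [tuple if enum_val i \in C then 0 else 'X_i | i < #|V|].

HB.instance Definition _ C := GRing.RMorphism.on (kill_vars C).

Lemma kill_vars_var C x : kill_vars C (x_ x) = if x \in C then 0 else x_ x.
Proof. by rewrite /kill_vars comp_mpolyXU -tnth_nth tnth_mktuple enum_rankK. Qed.

(** The nontrivial inclusion of [ker (kill_vars C)] in the ideal generated by
    the variables of [C].  Multiplicativity of the congruence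
    [p = kill_vars C p] modulo an ideal [J] reduces the claim to variables. *)
Lemma sub_kill_vars C (J : {pred R}) :
    0 \in J -> (forall a, {in J &, forall f g, a * f + g \in J}) ->
    {in C, forall x, x_ x \in J} ->
  forall p, p - kill_vars C p \in J.
Proof.
move=> J0 Jlin JC.
have JD f g : f \in J -> g \in J -> f + g \in J.
  by move=> fJ gJ; rewrite -[f]mul1r Jlin.
have JM a f : f \in J -> a * f \in J.
  by move=> fJ; rewrite -[a * f]addr0 Jlin.
have congM f g : f - kill_vars C f \in J -> g - kill_vars C g \in J ->
    f * g - kill_vars C (f * g) \in J.
  move=> fJ gJ; rewrite rmorphM.
  have -> : f * g - kill_vars C f * kill_vars C g
      = g * (f - kill_vars C f) + kill_vars C f * (g - kill_vars C g).
    by rewrite !mulrBr addrA [g * f]mulrC [g * _]mulrC subrK.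
  by apply: JD; apply: JM.
have congX i : 'X_i - kill_vars C 'X_i \in J.
  rewrite -[i]enum_valK -/(x_ (enum_val i)) kill_vars_var.
  by case: ifP => [iC|_]; rewrite ?subr0 ?subrr // JC.
have cong1 : 1 - kill_vars C 1 \in J by rewrite rmorph1 subrr.
elim/mpolyind => [|c m p _ _ IHp]; first by rewrite rmorph0 subrr.
rewrite rmorphD opprD addrACA; apply: JD => //.
rewrite -mul_mpolyC; apply: (congM).
  by rewrite /kill_vars comp_mpolyC subrr.
rewrite mpolyXE_id.
apply: (big_ind (fun q => q - kill_vars C q \in J)) => // i _.
by elim: (m i) => [|k IHk]; rewrite ?expr0 // exprS congM.
Qed.

Definition set_monomial A : R := \prod_(x in A) x_ x.

Lemma set_monomial_neq0 A : set_monomial A != 0.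
Proof.
apply/prodf_neq0 => x _; apply/negP => /eqP /(congr1 (mcoeff U_(enum_rank x))).
by rewrite mcoeffX eqxx mcoeff0 => /eqP; rewrite oner_eq0.
Qed.

Lemma set_monomial_homog A : set_monomial A \is #|A|.-homog.
Proof.
rewrite /set_monomial -sum1_card.
apply: (big_ind2 (fun (f : R) d => f \is d.-homog)).
- exact: dhomog1.
- by move=> f d g e; apply: dhomogM.
- by move=> x _; rewrite dhomogX /= mdeg1.
Qed.

Lemma kill_set_monomial A C :
  [disjoint A & C] -> kill_vars C (set_monomial A) = set_monomial A.
Proof.
move=> dAC; rewrite rmorph_prod; apply: eq_bigr => x xA /=.
by rewrite kill_vars_var (disjointFr dAC xA).
Qed.

End Specialization.

Section EdgeIdeals.
Variables (K : fieldType) (V : finType) (adj : rel V).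
Implicit Types (A C : {set V}).

Definition nbhd A : {set V} := [set y | [exists x in A, adj x y]].

(** Left to right, specialize at [N(A)]: covering kills every edge, hence the
    edge ideal, while stability fixes [x_A], which can then be cancelled in the
    domain.  Right to left, each variable [y] of [N(A)] lies in the colon
    ideal, since [y] has a neighbour [x] in [A] and the edge [x y] divides
    [y x_A]; [sub_kill_vars] extends this to the whole kernel. *)
Lemma colon_stable_monomial A :
    [disjoint A & nbhd A] -> vertex_cover adj (nbhd A) ->
  colon (edge_ideal adj K) (set_monomial K A)
    =i [pred g | kill_vars (nbhd A) g == 0].
Proof.
move=> stA covA g; rewrite !inE; apply/idP/eqP => [gI | g0].
  have kill_edges : {in [pred m | [exists x, exists y,
      adj x y && (m == vertex_var K x * vertex_var K y)]],
      forall m, kill_vars (nbhd A) m = 0}.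
    move=> m; rewrite inE => /existsP[x /existsP[y /andP[xy /eqP->]]].
    rewrite rmorphM /= !kill_vars_var.
    have /implyP/(_ xy) := forallP (forallP covA x) y.
    by case/orP=> ->; rewrite ?mul0r ?mulr0.
  have /eqP := ideal_gen_ker kill_edges gI.
  rewrite rmorphM /= kill_set_monomial // mulf_eq0.
  by rewrite (negPf (set_monomial_neq0 _ _)) orbF => /eqP.
suff: g - kill_vars (nbhd A) g \in colon (edge_ideal adj K) (set_monomial K A).
  by rewrite g0 subr0.
apply: sub_kill_vars => [|a f h fI hI|y].
- by rewrite inE mul0r ideal_gen0.
- by rewrite inE mulrDl -mulrA; apply: ideal_gen_linear.
rewrite inE => /existsP[x /andP[xA xy]].
rewrite inE /set_monomial (bigD1 x) //= mulrA mulrC.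
rewrite [vertex_var K y * _]mulrC -[_ * _]addr0.
apply: ideal_gen_linear; last exact: ideal_gen0.
apply: mem_ideal_gen; rewrite inE.
by apply/existsP; exists x; apply/existsP; exists y; rewrite xy eqxx.
Qed.

Lemma vnumber_degree_card A :
    [disjoint A & nbhd A] -> vertex_cover adj (nbhd A) ->
  vnumber_degree (edge_ideal adj K) #|A|.
Proof.
move=> stA covA; have colonE := colon_stable_monomial stA covA.
pose P : {pred {mpoly K[#|V|]}} := [pred g | kill_vars (nbhd A) g == 0].
exists (set_monomial K A), P.
split=> //; first exact: set_monomial_homog.
split; first exact: prime_ideal_ker.
by exists (set_monomial K A) => g; rewrite colonE.
Qed.

Hypothesis adj_sym : symmetric adj.
Hypothesis adj_irr : irreflexive adj.

(** If all neighbours of [c] were in [C], then [C] minus [c] would still cover;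
    the absence of loops is what covers the edges at [c] in that case. *)
Lemma minimum_cover_outer_neighbour C :
    vertex_cover adj C -> (forall D, vertex_cover adj D -> #|C| <= #|D|)%N ->
  {in C, forall c, exists2 s, s \notin C & adj s c}.
Proof.
move=> covC minC c cC; case: (pickP [pred s | (s \notin C) && adj s c]).
  by move=> s /andP[sC sc]; exists s.
move=> no_nb; suff /minC : vertex_cover adj (C :\ c).
  by rewrite [#|C|](cardsD1 c) cC ltnn.
apply/forallP => x; apply/forallP => y; apply/implyP => xy.
rewrite !inE; case: (eqVneq x c) => [xc | _] /=.
  subst x; have := no_nb y; rewrite /= adj_sym xy andbT => /negbFE ->.
  by rewrite andbT; apply: contraTneq xy => ->; rewrite adj_irr.
case: (eqVneq y c) => [yc | _] /=.
  by subst y; have := no_nb x; rewrite /= xy andbT => /negbFE ->.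
by have /implyP/(_ xy) := forallP (forallP covC x) y.
Qed.

(** [A] picks one outer neighbour for each vertex of a minimum cover [C].
    Since every edge at a vertex outside [C] leads into [C], the set [A] is
    stable and its neighbourhood does not exceed [C]. *)
Lemma small_stable_set_with_covering_nbhd :
  exists A, [/\ [disjoint A & nbhd A], vertex_cover adj (nbhd A)
              & (#|A| <= vertex_covering_number adj)%N].
Proof.
rewrite /vertex_covering_number; case: arg_minnP => [|C covC minC].
  by apply/forallP => x; apply/forallP => y; rewrite !inE implybT.
have outer := minimum_cover_outer_neighbour covC minC.
pose f c := odflt c [pick s | (s \notin C) && adj s c].
have fP c : c \in C -> (f c \notin C) && adj (f c) c.
  move=> /outer[s sC sc]; rewrite /f.
  by case: pickP => [//|/(_ s)]; rewrite sC sc.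
have AC x : x \in [set f c | c in C] -> x \notin C.
  by case/imsetP=> c /fP/andP[fcC _] ->.
have nbhdE : nbhd [set f c | c in C] = C.
  apply/setP => y; rewrite inE; apply/existsP/idP => [[x /andP[xA xy]] | yC].
    have /implyP/(_ xy) := forallP (forallP covC x) y.
    by rewrite (negPf (AC x xA)).
  by exists (f y); rewrite imset_f //; have /andP[] := fP y yC.
exists [set f c | c in C]; rewrite nbhdE leq_imset_card; split=> //.
by apply/pred0P => x /=; apply/andP => -[/AC /negPf ->].
Qed.

End EdgeIdeals.

Theorem proposition3p14 (K : fieldType) (V : finType) (adj : rel V)
    (adj_sym : symmetric adj) (adj_irr : irreflexive adj) :
  exists2 v : nat,
    is_vnumber (edge_ideal adj K) v & (v <= vertex_covering_number adj)%N.
Proof.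
have [A [stA covA leA]] := small_stable_set_with_covering_nbhd adj_sym adj_irr.
have exd : exists d, `[< vnumber_degree (edge_ideal adj K) d >].
  by exists #|A|; apply/asboolP/vnumber_degree_card.
case: (ex_minnP exd) => v /asboolP vI minv; exists v.
  by split=> // d /asboolP; apply: minv.
by apply: leq_trans leA; apply: minv; apply/asboolP/vnumber_degree_card.
Qed.
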